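(* Let $(X,\sigma)$ be a shift over a finite alphabet. If $(X,\sigma)$ is both language stable and sofic, then $(X,\sigma)$ is a shift of finite type.
   Context: Let $\mathcal{A}$ be a finite alphabet and $\mathcal{A}^*$ the set of finite words over it. A shift is a non-empty closed $\sigma$-invariant set $X\subset\mathcal{A}^{\mathbb{Z}}$, where $(\sigma x)_n=x_{n+1}$. $\mathcal{F}(X)$ is the set of words in $\mathcal{A}^*$ that occur in no element of $X$ (forbidden words). The set of minimal forbidden words is $\mathcal{M}(X)=\{w\in\mathcal{F}(X)\colon \text{no proper subword of } w \text{ lies in } \mathcal{F}(X)\}$. Put $LS(X)=\{n\in\mathbb{N}\colon \mathcal{M}(X)\cap\mathcal{A}^n\neq\emptyset\}$. The shift is language stable if $\lim_{k\to\infty}\inf_{n\in\mathbb{N}}\frac{|LS(X)\cap[n+1,n+k]|}{k}=0$; equivalently, if for every $k\in\mathbb{N}$ there is $n\in\mathbb{N}$ with $X_n=X_{n+k}$, where $X_n$ is the set of all $x\in\mathcal{A}^{\mathbb{Z}}$ no subword of which is an element of $\mathcal{F}(X)$ of length at most $n$. A shift of finite type is a shift that can be defined as the set of all $x\in\mathcal{A}^{\mathbb{Z}}$ containing no subword from some finite set of words. A factor of a shift is the image (again a shift, possibly over another finite alphabet) under a continuous map commuting with $\sigma$. A shift is sofic if it is a factor of a shift of finite type. *)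

(* Defs.v *)
From mathcomp Require Import all_boot all_order all_algebra finmap.
From mathcomp Require Import all_classical all_reals all_analysis.

Set Implicit Arguments.
Unset Strict Implicit.
Unset Printing Implicit Defensive.

Import Order.TTheory GRing.Theory Num.Theory.
Import numFieldNormedType.Exports.

Local Open Scope classical_set_scope.
Local Open Scope ring_scope.

(* Bi-infinite sequences over A, with the product of the discrete topologies. *)
Definition config (A : finType) : topologicalType :=
  {ptws int -> discrete_topology A}.

Definition shift_map (A : finType) (x : config A) : config A :=
  fun n : int => x (n + 1).

(* Invariance is the equality sigma(X) = X, as usual for two-sided shifts. *)
Definition is_shift (A : finType) (X : set (config A)) : Prop :=
  [/\ X !=set0, closed X & @shift_map A @` X = X].

Definition occurs (A : finType) (w : seq A) (x : config A) : Prop :=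
  exists i : int, w = [seq (x (i + j%:Z) : A) | j <- iota 0 (size w)].

Definition forbidden (A : finType) (X : set (config A)) : set (seq A) :=
  [set w | forall x, X x -> ~ occurs w x].

(* Subwords are contiguous, hence [infix] rather than [subseq]. *)
Definition minimal_forbidden (A : finType) (X : set (config A)) :
    set (seq A) :=
  [set w | forbidden X w /\
           forall u : seq A, infix u w -> u != w -> ~ forbidden X u].

Definition LS (A : finType) (X : set (config A)) : set nat :=
  [set n | exists2 w : seq A, minimal_forbidden X w & size w = n].

(* The value at k = 0 is the junk value 0, which does not affect the limit. *)
Definition language_stable (R : realType) (A : finType)
    (X : set (config A)) : Prop :=
  (fun k : nat =>
     inf (range (fun n : nat =>
       #|` fset_set (LS X `&` [set m : nat | (n + 1 <= m <= n + k)%N]) |%:R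
         / k%:R : R)))
  @ \oo --> (0 : R).

Definition SFT (A : finType) (X : set (config A)) : Prop :=
  is_shift X /\
  exists2 W : set (seq A), finite_set W &
    X = [set x | forall w, W w -> ~ occurs w x].

(* Only the restriction of f to Y matters: a map defined on Y alone extends to
   all configurations, because shifts are non-empty. *)
Definition is_factor (B A : finType) (Y : set (config B))
    (X : set (config A)) : Prop :=
  is_shift Y /\
  exists f : config B -> config A,
    [/\ {within Y, continuous f},
        (forall y, Y y -> f (shift_map y) = shift_map (f y)) &
        f @` Y = X].

Definition sofic (A : finType) (X : set (config A)) : Prop :=
  exists (B : finType) (Y : set (config B)), SFT Y /\ is_factor Y X.

(* Main.v *)
Require Import Defs.
From mathcomp Require Import all_boot all_order all_algebra finmap zify.
From mathcomp Require Import all_classical all_reals all_analysis.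

(** A word [aub], with letters [a] and [b], is minimal forbidden exactly when
    it is forbidden while [au] and [ub] are not.  In a sofic shift there are
    finitely many follower sets, the follower set of [v] being the set of [z]
    with [vz] in the language.  So if [u] is long, two of its prefixes [u1] and
    [u2] satisfy at once that [u1], [u2] have the same follower set and that
    [a u1], [a u2] have the same follower set.  Cutting out of [u] the segment
    between them changes the status of none of [aub], [au], [ub]: a shorter
    minimal forbidden word results, and the loss of length is at most a
    constant [p] (lemma [minimal_forbidden_shorten]).

    Suppose that there are arbitrarily long minimal forbidden words.  Shortening
    a long one again and again, the lengths descend by steps of at most [p], so
    that beyond some bound every window of [p] consecutive integers contains
    the length of a minimal forbidden word ([LS_bounded_gaps]).  These lengths
    then have lower density at least about [1/p] in all long windows, which
    language stability excludes ([bounded_gaps_not_language_stable]).  Hence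
    the minimal forbidden words are finite in number, and a shift is always the
    set of configurations that avoid its minimal forbidden words
    ([bounded_LS_SFT]).

    The finiteness of the follower sets ([sofic_follower]) is obtained on the
    covering shift of finite type [Y] directly.  By compactness the factor map
    [f] is a sliding block code of some radius ([sliding_block]), and points of
    [Y] that agree on a long enough central window can be cut at the origin and
    glued ([SFT_glue]).  Thus what may follow [v] in the image of [f] depends
    only on which central windows occur in points of [Y] whose image reads [v]
    just before the origin, and there are finitely many sets of windows. *)

Set Implicit Arguments.
Unset Strict Implicit.
Unset Printing Implicit Defensive.

Import Order.TTheory GRing.Theory Num.Theory.

Local Open Scope classical_set_scope.
Local Open Scope ring_scope.

(** * Words and their occurrences *)

Definition translate (A : finType) (i : int) (x : config A) : config A :=
  fun n => x (n + i).

Definition word_at (A : finType) (x : config A) (i : int) (n : nat) : seq A :=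
  [seq (x (i + j%:Z) : A) | j <- iota 0 n].

Definition language (A : finType) (X : set (config A)) (w : seq A) : Prop :=
  exists2 x, X x & occurs w x.

Definition agree (A : finType) (n : nat) (x y : config A) : Prop :=
  forall i : int, (`|i| <= n)%N -> x i = y i.

Lemma infix_size_eq (T : eqType) (u w : seq T) :
  infix u w -> (size w <= size u)%N -> u = w.
Proof.
case/infixP => s [t ->]; rewrite !size_cat => le.
have /size0nil-> : size s = 0%N by lia.
have /size0nil-> : size t = 0%N by lia.
by rewrite cats0.
Qed.

Section Words.
Variable A : finType.
Implicit Types (x y : config A) (w u v : seq A) (X : set (config A)).

Lemma size_word_at x i n : size (word_at x i n) = n.
Proof. by rewrite size_map size_iota. Qed.

Lemma word_atD x i m n :
  word_at x i (m + n) = word_at x i m ++ word_at x (i + m%:Z) n.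
Proof.
rewrite /word_at iotaD map_cat; congr (_ ++ _).
rewrite add0n -[in LHS](addn0 m) iotaDl -map_comp.
by apply: eq_map => j /=; congr (x _); lia.
Qed.

Lemma eq_word_at x y i k n :
  (forall j, (j < n)%N -> x (i + j%:Z) = y (k + j%:Z)) ->
  word_at x i n = word_at y k n.
Proof.
by move=> xy; apply/eq_in_map => j; rewrite mem_iota add0n => /= /xy.
Qed.

Lemma word_at_inj x y i k n : word_at x i n = word_at y k n ->
  forall j, (j < n)%N -> x (i + j%:Z) = y (k + j%:Z).
Proof.
move=> /eq_in_map xy j jn; apply: xy.
by rewrite mem_iota.
Qed.

Lemma word_at_translate x k i n :
  word_at (translate k x) i n = word_at x (i + k) n.
Proof. by apply: eq_word_at => j _; rewrite /translate; congr (x _); lia. Qed.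

Lemma occurs_infix u w x : infix u w -> occurs w x -> occurs u x.
Proof.
case/infixP => s [t ->] [i]; rewrite -/(word_at _ _ _) => e.
exists (i + (size s)%:Z); rewrite -/(word_at _ _ _).
move: e; rewrite !size_cat !word_atD => /eqP.
rewrite eqseq_cat ?size_word_at// => /andP[_].
by rewrite eqseq_cat ?size_word_at// => /andP[/eqP].
Qed.

Lemma language_infix X u w : infix u w -> language X w -> language X u.
Proof. by move=> uw [x Xx /(occurs_infix uw)]; exists x. Qed.

Lemma forbiddenE X w : forbidden X w <-> ~ language X w.
Proof.
by split=> [f [x /f]//|f x Xx wx]; apply: f; exists x.
Qed.

Lemma allowedE X w : ~ forbidden X w <-> language X w.
Proof.
split=> [f|l /forbiddenE//]; apply: contrapT => l; apply/f/forbiddenE/l.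
Qed.

(** A shortest forbidden subword is minimal forbidden. *)
Lemma forbidden_has_minimal X w : forbidden X w ->
  exists2 u, minimal_forbidden X u & infix u w.
Proof.
have [n] := ubnP (size w); elim: n w => // n IHn w; rewrite ltnS => wn fw.
have [|/asboolPn/existsNP[u]] := boolP `[< forall u, infix u w -> u != w ->
  ~ forbidden X u >].
  by move=> /asboolP mw; exists w; [split|exact: infix_refl].
move=> /not_implyP[uw] /not_implyP[neq] /contrapT fu.
have [|v mv vu] := IHn u _ fu; last by exists v => //; exact: infix_trans uw.
apply: leq_trans wn; rewrite ltnNge; apply: contra neq => wu.
exact/eqP/infix_size_eq.
Qed.

Lemma infix_split a u b v :
  infix v (a :: rcons u b) -> v != a :: rcons u b ->
  infix v (a :: u) || infix v (rcons u b).
Proof.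
rewrite infix_consl => /orP[|->]; last by rewrite orbT.
move=> /prefixP[t]; elim/last_ind: t => [|t c _].
  by rewrite cats0 => ->; rewrite eqxx.
rewrite -rcons_cat -rcons_cons => /rcons_inj[-> _ _].
by rewrite prefix_infix// prefix_prefix.
Qed.

(** Any proper subword of [aub] misses its first or its last letter, so only
    the two maximal proper subwords matter. *)
Lemma minimal_forbiddenP X a u b :
  minimal_forbidden X (a :: rcons u b) <->
  [/\ forbidden X (a :: rcons u b), language X (a :: u) &
      language X (rcons u b)].
Proof.
split=> [[fw mw]|[fw l1 l2]].
  split=> //; apply/allowedE; apply: mw.
  - by rewrite -rcons_cons infix_rcons.
  - by apply/eqP => /(congr1 size)/=; rewrite size_rcons; lia.
  - exact: infix_cons.
  - by apply/eqP => /(congr1 size)/=; rewrite size_rcons; lia.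
split=> // v vw /(infix_split vw) /orP[]vi; apply/allowedE;
  exact: language_infix vi _.
Qed.

End Words.

(** * Shortening minimal forbidden words *)

Section Pumping.
Variables (A : finType) (X : set (config A)) (T : finType) (s : seq A -> T).
Hypothesis follower : forall v v', s v = s v' ->
  forall z, language X (v ++ z) -> language X (v' ++ z).

(** Each prefix [u1] of the inner word [u] is labelled by the states of [u1]
    and of [a :: u1].  If [u] is at least as long as the number of labels, two
    prefixes share their label by the pigeonhole principle, and the segment
    between them can be removed. *)
Lemma minimal_forbidden_shorten w :
  minimal_forbidden X w -> (#|{: T * T}|.+2 <= size w)%N ->
  exists w', [/\ minimal_forbidden X w', (size w' < size w)%N &
    (size w <= size w' + #|{: T * T}|)%N].
Proof.
set p := #|_|; case: w => // a w; case/lastP: w => // u b.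
rewrite /= size_rcons !ltnS => /minimal_forbiddenP[fw l1 l2] pu.
(* There are [p.+1] prefixes of length at most [p], but only [p] labels. *)
pose g (i : 'I_p.+1) := (s (take i u), s (a :: take i u)).
have /injectivePn[i0 [j0 ij0 gij0]] : ~~ injectiveb g.
  apply/negP => /injectiveP/leq_card.
  by rewrite card_ord -/p ltnn.
wlog [i [j [ij /= gij]]]: / exists i j : 'I_p.+1, (i < j)%N /\ g i = g j.
  apply; have : (i0 : nat) != j0 by [].
  by rewrite neq_ltn => /orP[h|h]; [exists i0, j0|exists j0, i0]; split.
case: gij => g1 g2 {i0 j0 ij0 gij0}.
have jp := ltn_ord j.
have sz : size (take i u ++ drop j u) = (size u - (j - i))%N.
  by rewrite size_cat size_take size_drop; case: ltnP; lia.
exists (a :: rcons (take i u ++ drop j u) b); split; last first.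
- by rewrite /= size_rcons sz; lia.
- by rewrite /= size_rcons sz; lia.
apply/minimal_forbiddenP; rewrite -!cats1 -!cat_cons -!catA; split.
- apply/forbiddenE => /(follower g2); apply/forbiddenE.
  by rewrite catA cat_cons cat_take_drop -cats1 in fw *.
- by apply: (follower (esym g2)); rewrite cat_cons cat_take_drop.
- by apply: (follower (esym g1)); rewrite catA cat_take_drop cats1.
Qed.

(** Let [m] be the least element of [LS X] above [n].  If it exceeded [n] by
    more than the number of labels, shortening would give a smaller element of
    [LS X] that is still above [n]. *)
Lemma LS_bounded_gaps : (forall n, exists2 m, LS X m & (n < m)%N) ->
  forall n, (#|{: T * T}|.+2 <= n)%N ->
  exists2 m, LS X m & (n < m <= n + #|{: T * T}|)%N.
Proof.
set p := #|_|; move=> unb n np.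
have ex : exists m, `[< LS X m >] && (n < m)%N.
  by have [m Lm nm] := unb n; exists m; rewrite nm andbT; apply/asboolP.
case: (ex_minnP ex) => m /andP[/asboolP Lm nm] mmin.
exists m => //; rewrite nm leqNgt; apply/negP => mbig.
have [w mw wm] := Lm; have [|w' [mw' lt le]] := minimal_forbidden_shorten mw.
  by rewrite -/p; lia.
have := mmin (size w'); rewrite -/p in le; case: asboolP => [_|[]]; last by exists w'.
by lia.
Qed.

End Pumping.

(** * Topology of the full shift *)

Section Topology.
Variable A : finType.
Implicit Types (x y : config A).

Lemma agreeW m n x y : (m <= n)%N -> agree n x y -> agree m x y.
Proof. by move=> mn xy i im; apply: xy; exact: leq_trans mn. Qed.

Lemma nbhs_coord x (i : int) : nbhs x [set y : config A | y i = x i].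
Proof.
exact: (@proj_continuous int (fun=> discrete_topology A) i x
  [set x i] (discrete_set1 _)).
Qed.

Lemma nbhs_agree x n : nbhs x [set y | agree n x y].
Proof.
elim: n => [|n IHn].
  apply: filterS (nbhs_coord x 0) => y yx i i0.
  by have -> : i = 0 by lia.
apply: filterS (filterI IHn (filterI (nbhs_coord x n.+1%:Z)
  (nbhs_coord x (- n.+1%:Z)))) => y [xy [/= e1 e2]] i i0.
have [/xy//|ni] := leqP `|i| n.
by have [->|->] : i = n.+1%:Z \/ i = - n.+1%:Z by lia.
Qed.

(** The sets that contain a cylinder around [x] form a filter that converges
    to [x] coordinate by coordinate, hence converges to [x] in the product
    topology: so this filter contains every neighbourhood of [x]. *)
Lemma nbhs_agree_sub x (U : set (config A)) : nbhs x U ->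
  exists n, ([set y | agree n x y] `<=` U).
Proof.
pose F : set_system (config A) :=
  fun U => exists n, ([set y | agree n x y] `<=` U).
have FF : Filter F.
  split=> [|P Q [m mP] [n nQ]|P Q PQ [n nP]]; first by exists 0%N.
  - exists (maxn m n) => y xy; split; [apply: mP|apply: nQ];
      apply: (agreeW _ xy); lia.
  - by exists n => y /nP/PQ.
suff Fx : (F --> x) by move=> /Fx.
apply/cvg_sup => i V; rewrite nbhsE => -[B [[C _ <-] /= Cx] BV].
by exists `|i|%N => y xy; apply: BV; rewrite /= -xy.
Qed.

Lemma config_compact : compact [set: config A].
Proof.
have := @tychonoff int (fun=> discrete_topology A) (fun=> setT).
have -> : [set f : int -> discrete_topology A | forall i, setT (f i)] = setT.
  by rewrite predeqE.
apply=> _; exact/finite_compact/finite_finset.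
Qed.

Lemma closed_agree (X : set (config A)) x : closed X ->
  (forall n, exists2 y, X y & agree n x y) -> X x.
Proof.
move=> cX h; apply: cX => U /nbhs_agree_sub[n nU].
by have [y Xy xy] := h n; exists y; split=> //; exact: nU.
Qed.

Lemma translate0 x : translate 0 x = x.
Proof. by apply/funext => n; rewrite /translate addr0. Qed.

Lemma translateD x i j : translate i (translate j x) = translate (i + j) x.
Proof. by apply/funext => n; rewrite /translate addrA. Qed.

Lemma shift_mapE x : shift_map x = translate 1 x.
Proof. by []. Qed.

Lemma shift_translate (X : set (config A)) (i : int) x : is_shift X ->
  X x -> X (translate i x).
Proof.
case=> _ _ sX; elim/int_rect: i x => [|n IHn|n IHn] x Xx.
- by rewrite translate0.
- rewrite intS -translateD -shift_mapE -sX; exists (translate n%:Z x) => //.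
  exact: IHn.
- have [y Xy yx] : [set shift_map z | z in X] x by rewrite sX.
  have -> : translate (- n.+1%:Z) x = translate (- n%:Z) y.
    by rewrite -yx shift_mapE translateD; congr (translate _ y); lia.
  exact: IHn.
Qed.

End Topology.

(** * Shifts are determined by their language *)

Section ShiftLanguage.
Variables (A : finType) (X : set (config A)).
Hypothesis hX : is_shift X.

(** Shift invariance lets the position of the occurrence be prescribed. *)
Lemma languageP (k : int) w :
  language X w <-> exists2 x, X x & word_at x k (size w) = w.
Proof.
split=> [[x Xx [i wi]]|[x Xx wk]]; last by exists x => //; exists k; rewrite -[LHS]wk.
exists (translate (i - k) x); first exact: shift_translate.
by rewrite word_at_translate addrC subrK.
Qed.

(** The central words of [x] occur in points of [X], and can be translated to
    the origin there: [x] is thus a limit of points of [X]. *)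
Lemma shift_language x : (forall w, occurs w x -> language X w) -> X x.
Proof.
move=> h; apply: closed_agree => [|n]; first by case: hX.
have : language X (word_at x (- n%:Z) n.*2.+1).
  by apply: h; exists (- n%:Z); rewrite size_word_at.
move=> /(languageP (- n%:Z))[y Xy yx].
exists y => // i i0; rewrite size_word_at in yx.
have /(word_at_inj yx) : (`|(i + n%:Z)%R| < n.*2.+1)%N by lia.
have -> : - n%:Z + `|(i + n%:Z)%R|%N%:Z = i by lia.
by move=> ->.
Qed.

Lemma bounded_LS_SFT N : (forall n, LS X n -> (n <= N)%N) -> SFT X.
Proof.
move=> LSN; split=> //; exists (minimal_forbidden X).
  apply: (@sub_finite_set _ _ (\bigcup_(n in `I_N.+1)
      ((@tval n A) @` setT))); last first.
    by apply: bigcup_finite => [|n _]; [exact: finite_II|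
       exact/finite_image/finite_finset].
  move=> w mw; exists (size w); first by rewrite /= ltnS; apply: LSN; exists w.
  by exists (in_tuple w).
rewrite predeqE => x; split=> [Xx w [fw _] wx|h]; first exact: fw wx.
apply: shift_language => w wx; apply/allowedE => /forbidden_has_minimal[u mu uw].
exact: h mu (occurs_infix uw wx).
Qed.

End ShiftLanguage.

(** * Factor maps are sliding block codes *)

Section Factor.
Variables (A B : finType) (Y : set (config B)) (f : config B -> config A).
Hypothesis sY : is_shift Y.
Hypothesis fshift : forall y, Y y -> f (shift_map y) = shift_map (f y).

Lemma factor_translate i y : Y y -> f (translate i y) = translate i (f y).
Proof.
have pos n z : Y z -> f (translate n%:Z z) = translate n%:Z (f z).
  elim: n => [|n IHn] Yz; first by rewrite !translate0.
  rewrite intS -!translateD -!shift_mapE fshift ?IHn//.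
  exact: shift_translate.
move=> Yy; case: (intP i) => [|n|n]; [exact: (pos 0%N)|exact: pos|].
rewrite -[in RHS](translate0 y) -(subrr n.+1%:Z) -translateD pos.
  by rewrite translateD addNr translate0.
exact: shift_translate.
Qed.

Hypothesis fcont : {within Y, continuous f}.

(** The Curtis-Hedlund-Lyndon theorem.  If every radius [r] failed for some
    pair of points, then near a cluster point [y] of the first components,
    where continuity makes the coordinate [0] of the image constant, both
    members of some pair would have images with the same coordinate [0]. *)
Lemma sliding_block : exists r, forall y z, Y y -> Y z -> agree r y z ->
  f y 0 = f z 0.
Proof.
apply: contrapT => /forallNP h.
have {}h r : exists yz : config B * config B,
    [/\ Y yz.1, Y yz.2, agree r yz.1 yz.2 & f yz.1 0 <> f yz.2 0].
  have /existsNP[y /existsNP[z]] := h r.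
  move=> /not_implyP[Yy /not_implyP[Yz /not_implyP[yz n]]].
  by exists (y, z).
have [u hu] := choice h.
have cY : compact Y.
  by apply: subclosed_compact (@config_compact B) _ => //; case: sY.
have [|y [Yy cy]] := cY ((fun r => (u r).1) @ \oo).
  by exists 0%N => // r _ /=; have [] := hu r.
have : (nbhs y (fun z => Y z -> f z 0 = f y 0)).
  have := fcont (x := y : subspace Y) (nbhs_coord (f y) 0).
  by rewrite /= nbhs_simpl/= {1}/nbhs/= -nbhs_subspace_in.
move=> /nbhs_agree_sub[q qf].
have [|z [[r /= qr <-]]] := cy [set (u r).1 | r in [set r | (q <= r)%N]]
  [set z | agree q y z] _ (nbhs_agree y q).
  by exists q => // r /= qr; exists r.
move=> yu; have [Y1 Y2 u12] := hu r; apply.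
rewrite (qf _ yu Y1) (qf (u r).2)// => i iq.
by rewrite yu// u12//; exact: leq_trans qr.
Qed.

End Factor.

(** * Gluing points of a shift of finite type *)

Section Gluing.
Variable B : finType.
Implicit Types (y z : config B).

Definition glue y z : config B := fun n => if n < 0 then y n else z n.

(** If [K] bounds the lengths of the defining forbidden words, then any
    occurrence of such a word in [glue y z] that starts before [-K] ends before
    the origin and lies in [y]; any other one lies where [glue y z] agrees
    with [z]. *)
Lemma SFT_glue (Y : set (config B)) : SFT Y ->
  exists K, forall y z, Y y -> Y z -> agree K y z -> Y (glue y z).
Proof.
case=> _ [W finW YE].
have [K WK] : exists K, forall w, W w -> (size w <= K)%N.
  have [s Ws] := (finite_seqP W).1 finW.
  exists (\max_(w <- s) size w) => w; rewrite Ws => ws.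
  by apply: leq_bigmax_seq.
exists K => y z; rewrite YE => Yy Yz yz w Ww [i wi].
have wK := WK _ Ww.
have [iK|iK] := ltP i (- K%:Z).
  apply: (Yy _ Ww); exists i; rewrite [LHS]wi; apply: eq_word_at => j jw.
  by rewrite /glue ifT//; lia.
apply: (Yz _ Ww); exists i; rewrite [LHS]wi; apply: eq_word_at => j jw.
by rewrite /glue; case: ifPn => // ij; apply: yz; lia.
Qed.

End Gluing.

(** * Sofic shifts have finitely many follower sets *)

(** The state [s v] is the set of central windows of the points of the cover
    whose image reads [v] on the positions before [0].  If [y] is such a point
    for [v], followed by [z], and [y'] is one for [v'] with the same window,
    then the point that is [y'] before [0] and [y] from [0] on lies in the
    cover and is mapped to a point that reads [v' ++ z]. *)
Lemma sofic_follower (A : finType) (X : set (config A)) : is_shift X ->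
  sofic X ->
  exists (T : finType) (s : seq A -> T), forall v v', s v = s v' ->
    forall z, language X (v ++ z) -> language X (v' ++ z).
Proof.
move=> hX [B [Y [SY [sY [f [fc fs fY]]]]]].
have [K0 glueK] := SFT_glue SY; have [r fr] := sliding_block sY fc.
pose K := maxn K0 r.
pose reads y v := Y y /\ word_at (f y) (- (size v)%:Z) (size v) = v.
pose window (y : config B) : {ffun 'I_K.*2.+1 -> B} :=
  [ffun j : 'I_K.*2.+1 => y (j%:Z - K%:Z)].
pose s v : {ffun {ffun 'I_K.*2.+1 -> B} -> bool} :=
  [ffun c => `[< exists2 y, reads y v & window y = c >]].
exists {ffun {ffun 'I_K.*2.+1 -> B} -> bool}, s => v v' sv z.
move=> /(languageP hX (- (size v)%:Z))[x Xx].
have [y Yy <-] : [set f y | y in Y] x by rewrite fY.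
rewrite size_cat word_atD addNr => /eqP.
rewrite eqseq_cat ?size_word_at// => /andP[/eqP yv /eqP yz].
have : s v (window y) by rewrite ffunE; apply/asboolP; exists y.
rewrite sv ffunE => /asboolP[y' [Yy' yv'] wy].
have agK : agree K y' y.
  move=> i iK; have ltK : (`|(i + K%:Z)%R| < K.*2.+1)%N by lia.
  move: wy => /ffunP/(_ (Ordinal ltK)); rewrite !ffunE /=.
  by have -> : `|(i + K%:Z)%R|%N%:Z - K%:Z = i by lia.
have Yg : Y (glue y' y) by apply: glueK => //; apply: agreeW agK; lia.
have fE (i : int) y0 : Y y0 -> f y0 i = f (translate i y0) 0.
  by move=> Yy0; rewrite (factor_translate sY)// /translate add0r.
(* The block of radius [r] around [i < 0] stays left of [r <= K], where the
   glued point agrees with [y']; symmetrically for [i >= 0]. *)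
have fneg i : i < 0 -> f (glue y' y) i = f y' i.
  move=> i0; rewrite (fE i _ Yg) (fE i _ Yy'); apply: fr; try exact: shift_translate.
  move=> j jr; rewrite /translate /glue; case: ifPn => // ji.
  by rewrite agK//; lia.
have fpos i : 0 <= i -> f (glue y' y) i = f y i.
  move=> i0; rewrite (fE i _ Yg) (fE i _ Yy); apply: fr; try exact: shift_translate.
  move=> j jr; rewrite /translate /glue; case: ifPn => // ji.
  by rewrite agK//; lia.
apply/(languageP hX (- (size v')%:Z)); exists (f (glue y' y)).
  by rewrite -fY; exists (glue y' y).
rewrite size_cat word_atD addNr; congr (_ ++ _).
  by rewrite -[RHS]yv'; apply: eq_word_at => j jv; apply: fneg; lia.
by rewrite -[RHS]yz; apply: eq_word_at => j jz; apply: fpos; lia.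
Qed.

(** * Bounded gaps contradict language stability *)

(** A window of length [n0 + p * q] contains [q] disjoint windows of length
    [p] beyond [n0], hence at least [q] elements of [LS X].  Once [q >= n0] and
    [q > 0], the proportion [q / (n0 + p * q)] is at least [1 / (p + 1)]. *)
Lemma bounded_gaps_not_language_stable (R : realType) (A : finType)
    (X : set (config A)) (n0 p : nat) :
  (forall n, (n0 <= n)%N -> exists2 m, LS X m & (n < m <= n + p)%N) ->
  ~ language_stable R X.
Proof.
move=> gap /cvgrPdist_lt/(_ (p.+1%:R^-1)); rewrite invr_gt0 ltr0n.
move=> /(_ isT)[N _ hN]; pose q := (maxn n0 (maxn N 1))%N.
pose k := (n0 + p * q)%N.
have p0 : (0 < p)%N by have [m _] := gap n0 (leqnn _); lia.
have kN : (N <= k)%N by rewrite /k /q; nia.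
have := hN k kN; apply/negP; rewrite -leNgt sub0r normrN.
apply: le_trans (ler_norm _); apply: lb_le_inf; first by eexists; exists 0%N.
move=> _ [n _ <-].
(* Pick one element of [LS X] in each of the [q] windows of length [p]. *)
have card_ge : (q <= #|` fset_set (LS X `&` [set m : nat | (n + 1 <= m <= n + k)%N])|)%N.
  have next j : exists m, LS X m /\
      (n + n0 + p * j < m <= n + n0 + p * j + p)%N.
    have [|m Lm mj] := gap (n + n0 + p * j)%N; first by lia.
    by exists m.
  have [g Lg] := choice next.
  rewrite -[q](size_iota 0) -(size_map g); apply: uniq_leq_size.
    rewrite map_inj_in_uniq ?iota_uniq// => i j _ _ gij.
    by have [_ ] := Lg i; have [_] := Lg j; rewrite gij; nia.
  move=> _ /mapP[j + ->]; rewrite mem_iota => jq.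
  rewrite in_fset_set; last first.
    apply: (@sub_finite_set _ _ `I_(n + k).+1); last exact: finite_II.
    by move=> m [_ /=]; lia.
  have [L1 L2] := Lg j.
  apply/mem_set; split=> //=; rewrite /k; nia.
have k0 : (0 < k)%N by rewrite /k /q; nia.
rewrite ler_pdivlMr ?ltr0n// mulrC ler_pdivrMr ?ltr0n// -natrM ler_nat.
apply: leq_trans (leq_mul card_ge (leqnn _)); rewrite /k /q; nia.
Qed.

Theorem theorem1p1 (R : realType) (A : finType) (X : set (config A))
    (hX : is_shift X) (hls : language_stable R X) (hsof : sofic X) :
  SFT X.
Proof.
have [T [s hs]] := sofic_follower hX hsof.
have [[N LSN]|unb] := pselect (exists N, forall n, LS X n -> (n <= N)%N).
  exact: (bounded_LS_SFT hX LSN).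
exfalso; apply: bounded_gaps_not_language_stable (LS_bounded_gaps hs _) hls => N.
have /forallNP/(_ N)/existsNP[m] := unb.
by move=> /not_implyP[Lm /negP]; rewrite -ltnNge; exists m.
Qed.
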